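(* Let $\mathbf{k}$ be an algebraically closed field of characteristic $0$, let $G$ be a finite group acting on a $\mathbf{k}$-linear algebraic triangulated category $\mathsf{T}$, and let $(\mathsf{X},\mathsf{Y})$ be a $G$-invariant t-structure on $\mathsf{T}$. Then the pair $(\mathsf{X}^G,\mathsf{Y}^G)$ of $G$-equivariant categories forms a t-structure on $\mathsf{T}^G$.
   Context: A t-structure in a triangulated category with suspension $\Sigma$ is a pair of full subcategories $(\mathsf{X},\mathsf{Y})$ with (i) $\Sigma\mathsf{X}\subseteq\mathsf{X}$; (ii) $\mathrm{Hom}(\mathsf{X},\mathsf{Y})=0$; (iii) every object $t$ has a distinguished triangle $t_{\mathsf{X}}\to t\to t_{\mathsf{Y}}\to\Sigma t_{\mathsf{X}}$ with $t_{\mathsf{X}}\in\mathsf{X}$, $t_{\mathsf{Y}}\in\mathsf{Y}$. An action of $G$ on $\mathsf{T}$ is a collection of autoequivalences $g\colon\mathsf{T}\to\mathsf{T}$ (exact, $\mathbf{k}$-linear), one for each $g\in G$, with the identity element acting as the identity functor, together with given functor isomorphisms for the relations in $G$ (i.e. isomorphisms $g\circ h\cong gh$) satisfying the natural compatibility (cocycle) conditions; equivalently, a functor of groupoids $\underline{G}\to\underline{\mathrm{Aut}}(\mathsf{T})$. The equivariant category $\mathsf{T}^G$ has as objects pairs $(t,\tau)$ with $t\in\mathsf{T}$ and $\tau=(\tau_g\colon t\xrightarrow{\sim}g(t))_{g\in G}$ a compatible collection of isomorphisms (a linearisation, i.e. $\tau_{gh}=g(\tau_h)\circ\tau_g$ up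 to the given isomorphisms $g\circ h\cong gh$). $\mathrm{Hom}_{\mathsf{T}^G}((t,\tau),(t',\tau')):=\mathrm{Hom}_{\mathsf{T}}(t,t')^G$, the $G$-invariants for the $G$-representation on $\mathrm{Hom}_{\mathsf{T}}(t,t')$ given by the linearisations. Algebraic means presented as the homotopy category of a dg category; then $\mathsf{T}^G$ is triangulated, with suspension induced by that of $\mathsf{T}$, and a triangle in $\mathsf{T}^G$ is distinguished iff its underlying triangle in $\mathsf{T}$ is. A t-structure $(\mathsf{X},\mathsf{Y})$ is $G$-invariant if $g\mathsf{X}=\mathsf{X}$ and $g\mathsf{Y}=\mathsf{Y}$ for all $g\in G$. The $G$-action then restricts to $\mathsf{X}$ and $\mathsf{Y}$, and $\mathsf{X}^G$, $\mathsf{Y}^G$ denote the resulting equivariant categories, viewed as the full subcategories of $\mathsf{T}^G$ of objects $(t,\tau)$ with $t\in\mathsf{X}$, respectively $t\in\mathsf{Y}$. *)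

(* Defs.v *)
From HB Require Import structures.
From mathcomp Require Import all_boot all_order all_algebra all_fingroup.
From mathcomp Require Import generic_quotient ring_quotient boolp.

Set Implicit Arguments.
Unset Strict Implicit.
Unset Printing Implicit Defensive.
Import GRing.Theory.
Local Open Scope ring_scope.

Reserved Notation "g \co f" (at level 40, left associativity).
Reserved Notation "g \dco f" (at level 40, left associativity).

Section Modules.
Variables (R : pzRingType) (V : lmodType R).

Definition submodule (S : submodClosed V) : Type := {x : V | x \in S}.

Section Sub.
Variable S : submodClosed V.
HB.instance Definition _ := SubChoice.on (submodule S).
HB.instance Definition _ := [SubChoice_isSubLmodule of submodule S by <:].
End Sub.

Definition submod_pred (S : submodClosed V) : {pred V} := S.
Fact submod_pred_zmod S : zmod_closed (submod_pred S).
Proof. exact: GRing.submod_closedB (submodClosedP S). Qed.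
HB.instance Definition _ S :=
  GRing.isZmodClosed.Build V (submod_pred S) (submod_pred_zmod S).

Definition quotient_module (S : submodClosed V) : Type :=
  Quotient.quot (submod_pred S).

Section Quot.
Variable S : submodClosed V.
Local Notation Q := (quotient_module S).

HB.instance Definition _ := GRing.Zmodule.on Q.

Definition qpi (x : V) : Q := \pi_((Quotient.quot (submod_pred S)))%qT x.
Definition qrepr (q : Q) : V := repr (q : (Quotient.quot (submod_pred S))).

Lemma qreprK q : qpi (qrepr q) = q.
Proof. exact: reprK. Qed.

Lemma qpi_eq x y : (qpi x = qpi y) <-> (x - y \in S).
Proof.
have := Quotient.idealrBE (submod_pred S) x y.
rewrite -[_ \in _]/(x - y \in S) => ->.
by split => /eqP.
Qed.

Lemma qrepr_sub x : qrepr (qpi x) - x \in S.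
Proof. by apply/qpi_eq; rewrite qreprK. Qed.

Lemma qpiD x y : qpi (x + y) = qpi x + qpi y.
Proof. exact: (raddfD (\pi_((Quotient.quot (submod_pred S)))%qT)). Qed.

Definition qscale (a : R) (q : Q) : Q := qpi (a *: qrepr q).

Lemma qscale_pi a x : qscale a (qpi x) = qpi (a *: x).
Proof. by apply/qpi_eq; rewrite -scalerBr rpredZ // qrepr_sub. Qed.

Fact qscaleA a b q : qscale a (qscale b q) = qscale (a * b) q.
Proof. by rewrite -(qreprK q) !qscale_pi scalerA. Qed.
Fact qscale1 : left_id 1 qscale.
Proof. by move=> q; rewrite -(qreprK q) qscale_pi scale1r. Qed.
Fact qscaleDr : right_distributive qscale +%R.
Proof.
by move=> a q r; rewrite -(qreprK q) -(qreprK r) -qpiD !qscale_pi scalerDr qpiD.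
Qed.
Fact qscaleDl q : {morph qscale^~ q : a b / a + b}.
Proof. by move=> a b /=; rewrite -(qreprK q) !qscale_pi scalerDl qpiD. Qed.

HB.instance Definition _ :=
  GRing.Zmodule_isLmodule.Build R Q qscaleA qscale1 qscaleDr qscaleDl.

Lemma qpiP a x y : qpi (a *: x + y) = a *: qpi x + qpi y.
Proof. by rewrite qpiD -qscale_pi. Qed.
End Quot.
End Modules.

Section LinearCategories.
Variable k : fieldType.

Record lcat := LCat {
  obj :> Type;
  hom : obj -> obj -> lmodType k;
  idm : forall x, hom x x;
  comp : forall x y z, hom y z -> hom x y -> hom x z;
  compA : forall x y z t (h : hom z t) (g : hom y z) (f : hom x y),
    comp h (comp g f) = comp (comp h g) f;
  comp1m : forall x y (f : hom x y), comp (idm y) f = f;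
  compm1 : forall x y (f : hom x y), comp f (idm x) = f;
  comp_linl : forall x y z (f : hom x y) a (g g' : hom y z),
    comp (a *: g + g') f = a *: comp g f + comp g' f;
  comp_linr : forall x y z (g : hom y z) a (f f' : hom x y),
    comp g (a *: f + f') = a *: comp g f + comp g f' }.
End LinearCategories.

Arguments idm {k C} x : rename.
Arguments hom {k C} x y : rename.
Arguments comp {k C x y z} g f : rename.
Local Notation "g \co f" := (comp g f).

Section Isos.
Variables (k : fieldType) (C : lcat k).

Record iso (x y : C) := Iso {
  fwd : hom x y;
  bwd : hom y x;
  bwdK : bwd \co fwd = idm x;
  fwdK : fwd \co bwd = idm y }.

Definition isomorphic (x y : C) : Prop := inhabited (iso x y).

Definition iso_id (x : C) : iso x x := Iso (comp1m (idm x)) (comp1m (idm x)).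
Definition iso_inv x y (i : iso x y) : iso y x := Iso (fwdK i) (bwdK i).

Lemma cancel_mid (x y z t : C) (h : hom y t) (b : hom z y) (f : hom y z) (g : hom x y) :
  b \co f = idm y -> (h \co b) \co (f \co g) = h \co g.
Proof. by move=> bf; rewrite compA -(compA h) bf compm1. Qed.

Definition iso_comp x y z (j : iso y z) (i : iso x y) : iso x z.
Proof.
apply: (@Iso _ _ (fwd j \co fwd i) (bwd i \co bwd j)).
- by rewrite cancel_mid ?bwdK.
- by rewrite cancel_mid ?fwdK.
Defined.

Definition is_zero (x : C) : Prop := idm x = 0.

Definition is_biproduct (x y p : C) : Prop :=
  exists (i1 : hom x p) (i2 : hom y p) (p1 : hom p x) (p2 : hom p y),
    [/\ p1 \co i1 = idm x, p2 \co i2 = idm y, p1 \co i2 = 0, p2 \co i1 = 0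
      & i1 \co p1 + i2 \co p2 = idm p].

Definition additive_category : Prop :=
  (exists z, is_zero z) /\ forall x y, exists p, is_biproduct x y p.

End Isos.

Section Functors.
Variable k : fieldType.

Record lfunctor (C D : lcat k) := LFunctor {
  fobj :> C -> D;
  fmap : forall x y, hom x y -> hom (fobj x) (fobj y);
  fmap_lin : forall x y a (f f' : hom x y),
    fmap (a *: f + f') = a *: fmap f + fmap f';
  fmap1 : forall x, fmap (idm x) = idm (fobj x);
  fmapM : forall x y z (g : hom y z) (f : hom x y),
    fmap (g \co f) = fmap g \co fmap f }.

Definition iso_map C D (F : lfunctor C D) x y (i : iso x y) : iso (F x) (F y).
Proof.
by apply: (@Iso _ _ _ _ (fmap F (fwd i)) (fmap F (bwd i)));
  rewrite -fmapM ?bwdK ?fwdK fmap1.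
Defined.

Definition lfunctor_id C : lfunctor C C.
Proof. by apply: (@LFunctor C C id (fun x y f => f)). Defined.

Definition lfunctor_comp C D E (G : lfunctor D E) (F : lfunctor C D) :
  lfunctor C E.
Proof.
apply: (@LFunctor C E (fun x => G (F x)) (fun x y f => fmap G (fmap F f))).
- by move=> *; rewrite !fmap_lin.
- by move=> *; rewrite !fmap1.
- by move=> *; rewrite !fmapM.
Defined.

Record nat_iso C D (F G : lfunctor C D) := NatIso {
  nat_isoE :> forall x, iso (F x) (G x);
  nat_isoN : forall x y (f : hom x y),
    fwd (nat_isoE y) \co fmap F f = fmap G f \co fwd (nat_isoE x) }.

Definition is_equivalence C D (F : lfunctor C D) : Prop :=
  exists L : lfunctor D C,
    inhabited (nat_iso (lfunctor_comp L F) (lfunctor_id C)) /\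
    inhabited (nat_iso (lfunctor_comp F L) (lfunctor_id D)).

End Functors.

Section Triangles.
Variables (k : fieldType) (C : lcat k) (S : lfunctor C C).

Definition triangle_iso (x y z x' y' z' : C)
    (u : hom x y) (v : hom y z) (w : hom z (S x))
    (u' : hom x' y') (v' : hom y' z') (w' : hom z' (S x')) : Prop :=
  exists (a : iso x x') (b : iso y y') (c : iso z z'),
    [/\ fwd b \co u = u' \co fwd a, fwd c \co v = v' \co fwd b
      & fmap S (fwd a) \co w = w' \co fwd c].
End Triangles.

(* A linear category with an endofunctor Sigma and a class of distinguished
   triangles, before any axiom is imposed. *)
Record tridata (k : fieldType) := TriData {
  tcat :> lcat k;
  susp : lfunctor tcat tcat;
  dist : forall x y z : tcat,
    hom x y -> hom y z -> hom z (susp x) -> Prop }.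

Arguments susp {k T} : rename.
Arguments dist {k T x y z} u v w : rename.

Record triangulated (k : fieldType) (T : tridata k) : Prop := Triangulated {
  tr_additive : additive_category T;
  tr_susp : is_equivalence (susp (T := T));
  tr_iso : forall (x y z x' y' z' : T)
    (u : hom x y) (v : hom y z) (w : hom z (susp x))
    (u' : hom x' y') (v' : hom y' z') (w' : hom z' (susp x')),
    triangle_iso u v w u' v' w' -> dist u v w -> dist u' v' w';
  tr_id : forall x z : T, is_zero z ->
    dist (idm x) (0 : hom x z) (0 : hom z (susp x));
  tr_cone : forall (x y : T) (u : hom x y),
    exists z (v : hom y z) (w : hom z (susp x)), dist u v w;
  tr_rot : forall (x y z : T) (u : hom x y) (v : hom y z) (w : hom z (susp x)),
    dist u v w <-> dist v w (- fmap susp u);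
  tr_mor : forall (x y z x' y' z' : T)
    (u : hom x y) (v : hom y z) (w : hom z (susp x))
    (u' : hom x' y') (v' : hom y' z') (w' : hom z' (susp x'))
    (a : hom x x') (b : hom y y'),
    dist u v w -> dist u' v' w' -> b \co u = u' \co a ->
    exists c : hom z z', c \co v = v' \co b /\ fmap susp a \co w = w' \co c;
  tr_oct : forall (x y z x' y' z' : T) (f : hom x y) (g : hom y z)
    (a : hom y z') (b : hom z' (susp x))
    (a2 : hom z x') (b2 : hom x' (susp y))
    (a3 : hom z y') (b3 : hom y' (susp x)),
    dist f a b -> dist g a2 b2 -> dist (g \co f) a3 b3 ->
    exists (m : hom z' y') (n : hom y' x'),
      [/\ dist m n (fmap susp a \co b2),
          m \co a = a3 \co g, b3 \co m = b,
          n \co a3 = a2 & b2 \co n = fmap susp f \co b3] }.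

Record t_structure (k : fieldType) (T : tridata k) (X Y : T -> Prop) : Prop :=
  TStructure {
    ts_susp : forall x, X x -> X (susp x);
    ts_hom : forall x y, X x -> Y y -> forall f : hom x y, f = 0;
    ts_tri : forall t : T,
      exists (x y : T) (u : hom x t) (v : hom t y) (w : hom y (susp x)),
        [/\ X x, Y y & dist u v w] }.

Section ExactFunctors.
Variable k : fieldType.

Record exact_functor (S T : tridata k) := ExactFunctor {
  efun :> lfunctor S T;
  efun_susp : nat_iso (lfunctor_comp efun susp) (lfunctor_comp susp efun);
  efun_dist : forall (x y z : S) (u : hom x y) (v : hom y z) (w : hom z (susp x)),
    dist u v w -> dist (fmap efun u) (fmap efun v)
                       (fwd (efun_susp x) \co fmap efun w) }.

Definition exact_id T : exact_functor T T.
Proof.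
unshelve apply: (@ExactFunctor T T (lfunctor_id T)).
- unshelve eapply NatIso; first by move=> x; exact: iso_id.
  by move=> x y f /=; rewrite comp1m compm1.
- by move=> x y z u v w /=; rewrite comp1m.
Defined.

Definition exact_comp S T U (G : exact_functor T U) (F : exact_functor S T) :
  exact_functor S U.
Proof.
unshelve apply: (@ExactFunctor S U (lfunctor_comp G F)).
- unshelve eapply NatIso.
    by move=> x; exact: iso_comp (efun_susp G (F x)) (iso_map G (efun_susp F x)).
  move=> x y f /=; rewrite -compA -fmapM.
  have /= -> := nat_isoN (efun_susp F) f.
  rewrite fmapM compA.
  by have /= -> := nat_isoN (efun_susp G) (fmap F f); rewrite -compA.
- move=> x y z u v w duvw /=.
  have := efun_dist G (efun_dist F duvw).
  by rewrite fmapM compA.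
Defined.

Record exact_iso S T (F F' : exact_functor S T) := ExactIso {
  eiso :> nat_iso F F';
  eiso_susp : forall x,
    fwd (efun_susp F' x) \co fwd (eiso (susp x))
    = fmap susp (fwd (eiso x)) \co fwd (efun_susp F x) }.

End ExactFunctors.

(* A dg category, with Hom complexes graded internally: dgdeg n cuts out the
   degree n part of the k-module dghom x y, and d is a differential of
   cohomological degree 1. *)
Record dgcat (k : fieldType) := DGCat {
  dgobj :> Type;
  dghom : dgobj -> dgobj -> lmodType k;
  dgdeg : forall x y, int -> dghom x y -> Prop;
  dgdeg0 : forall x y n, dgdeg n (0 : dghom x y);
  dgdeg_lin : forall x y n a (f g : dghom x y),
    dgdeg n f -> dgdeg n g -> dgdeg n (a *: f + g);
  dgdeg_sum : forall x y (f : dghom x y),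
    exists (s : seq int) (c : int -> dghom x y),
      (forall n, dgdeg n (c n)) /\ f = \sum_(n <- s) c n;
  dgdeg_direct : forall x y (s : seq int) (c : int -> dghom x y),
    uniq s -> (forall n, dgdeg n (c n)) -> \sum_(n <- s) c n = 0 ->
    forall n, n \in s -> c n = 0;
  dgd : forall x y, dghom x y -> dghom x y;
  dgd_lin : forall x y a (f g : dghom x y),
    dgd (a *: f + g) = a *: dgd f + dgd g;
  dgd_deg : forall x y n (f : dghom x y), dgdeg n f -> dgdeg (n + 1) (dgd f);
  dgdd : forall x y (f : dghom x y), dgd (dgd f) = 0;
  dgid : forall x, dghom x x;
  dgcomp : forall x y z, dghom y z -> dghom x y -> dghom x z;
  dgcompA : forall x y z t (h : dghom z t) (g : dghom y z) (f : dghom x y),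
    dgcomp h (dgcomp g f) = dgcomp (dgcomp h g) f;
  dgcomp1m : forall x y (f : dghom x y), dgcomp (dgid y) f = f;
  dgcompm1 : forall x y (f : dghom x y), dgcomp f (dgid x) = f;
  dgcomp_linl : forall x y z (f : dghom x y) a (g g' : dghom y z),
    dgcomp (a *: g + g') f = a *: dgcomp g f + dgcomp g' f;
  dgcomp_linr : forall x y z (g : dghom y z) a (f f' : dghom x y),
    dgcomp g (a *: f + f') = a *: dgcomp g f + dgcomp g f';
  dgid_deg : forall x, dgdeg 0 (dgid x);
  dgcomp_deg : forall x y z m n (g : dghom y z) (f : dghom x y),
    dgdeg m g -> dgdeg n f -> dgdeg (m + n) (dgcomp g f);
  dgLeibniz : forall x y z m (g : dghom y z) (f : dghom x y), dgdeg m g ->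
    dgd (dgcomp g f) = dgcomp (dgd g) f + ((-1) ^ m) *: dgcomp g (dgd f) }.

Arguments dghom {k A} x y : rename.
Arguments dgid {k A} x : rename.
Arguments dgcomp {k A x y z} g f : rename.
Local Notation "g \dco f" := (dgcomp g f).

Section HomotopyCategory.
Variables (k : fieldType) (A : dgcat k).
Implicit Types x y z : A.

Lemma dgcomp0m x y z (f : dghom x y) : (0 : dghom y z) \dco f = 0.
Proof.
by have := dgcomp_linl f (-1) (0 : dghom y z) 0; rewrite scaler0 addr0 scaleN1r addNr.
Qed.
Lemma dgcompm0 x y z (g : dghom y z) : g \dco (0 : dghom x y) = 0.
Proof.
by have := dgcomp_linr g (-1) (0 : dghom x y) 0; rewrite scaler0 addr0 scaleN1r addNr.
Qed.
Lemma dgcompBl x y z (f : dghom x y) (g g' : dghom y z) :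
  (g - g') \dco f = g \dco f - g' \dco f.
Proof. by rewrite -scaleN1r addrC dgcomp_linl scaleN1r addrC. Qed.
Lemma dgcompBr x y z (g : dghom y z) (f f' : dghom x y) :
  g \dco (f - f') = g \dco f - g \dco f'.
Proof. by rewrite -scaleN1r addrC dgcomp_linr scaleN1r addrC. Qed.
Lemma dgd0 x y : dgd (0 : dghom x y) = 0.
Proof. by have := dgd_lin (-1) (0 : dghom x y) 0; rewrite scaler0 addr0 scaleN1r addNr. Qed.
Lemma dgd_id x : dgd (dgid x) = 0.
Proof.
have := dgLeibniz (dgid x) (dgid_deg x).
rewrite dgcompm1 expr0z scale1r dgcompm1 dgcomp1m => /eqP.
by rewrite eq_sym -subr_eq0 addrK => /eqP.
Qed.

Definition dgclosed x y : {pred dghom x y} :=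
  fun f => `[< dgdeg 0 f /\ dgd f = 0 >].

Fact dgclosed_submod x y : submod_closed (@dgclosed x y).
Proof.
split; first by apply/asboolP; split; [exact: dgdeg0 | exact: dgd0].
move=> a f g /asboolP [f0 df] /asboolP [g0 dg]; apply/asboolP.
by split; [exact: dgdeg_lin | rewrite dgd_lin df dg scaler0 addr0].
Qed.
HB.instance Definition _ x y :=
  GRing.isSubmodClosed.Build k (dghom x y) (@dgclosed x y) (@dgclosed_submod x y).

Definition Z0 x y : lmodType k := submodule (@dgclosed x y).

Definition dgexact x y : {pred Z0 x y} :=
  fun f => `[< exists h : dghom x y, dgdeg (-1) h /\ dgd h = val f >].

Fact dgexact_submod x y : submod_closed (@dgexact x y).
Proof.
split; first by apply/asboolP; exists 0; split; [exact: dgdeg0 | exact: dgd0].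
move=> a f g /asboolP [h [h1 dh]] /asboolP [h' [h1' dh']]; apply/asboolP.
exists (a *: h + h'); split; first exact: dgdeg_lin.
by rewrite dgd_lin dh dh'.
Qed.
HB.instance Definition _ x y :=
  GRing.isSubmodClosed.Build k (Z0 x y) (@dgexact x y) (@dgexact_submod x y).

Definition H0hom x y : lmodType k := quotient_module (@dgexact x y).

Definition mkZ0 x y (f : dghom x y) (f0 : dgdeg 0 f) (df : dgd f = 0) : Z0 x y :=
  exist _ f (asboolT (conj f0 df)).

Lemma Z0P x y (f : Z0 x y) : dgdeg 0 (val f) /\ dgd (val f) = 0.
Proof. by case: f => f /= /asboolP. Qed.

Definition Z0id x : Z0 x x := mkZ0 (dgid_deg x) (dgd_id x).

Fact Z0comp_proof x y z (g : Z0 y z) (f : Z0 x y) :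
  dgdeg 0 (val g \dco val f) /\ dgd (val g \dco val f) = 0.
Proof.
have [g0 dg] := Z0P g; have [f0 df] := Z0P f.
split; first exact: (dgcomp_deg g0 f0).
by rewrite (dgLeibniz _ g0) dg df dgcomp0m dgcompm0 scaler0 addr0.
Qed.
Definition Z0comp x y z (g : Z0 y z) (f : Z0 x y) : Z0 x z :=
  mkZ0 (proj1 (Z0comp_proof g f)) (proj2 (Z0comp_proof g f)).

Definition H0cls x y (f : Z0 x y) : H0hom x y := qpi (@dgexact x y) f.
Definition H0repr x y (q : H0hom x y) : Z0 x y := qrepr q.

Definition H0comp x y z (g : H0hom y z) (f : H0hom x y) : H0hom x z :=
  H0cls (Z0comp (H0repr g) (H0repr f)).

Lemma H0reprK x y (q : H0hom x y) : H0cls (H0repr q) = q.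
Proof. exact: qreprK. Qed.

Lemma H0cls_lin x y a (f g : Z0 x y) : H0cls (a *: f + g) = a *: H0cls f + H0cls g.
Proof. exact: qpiP. Qed.

Lemma H0cls_eq x y (f g : Z0 x y) :
  (exists h, dgdeg (-1) h /\ dgd h = val f - val g) -> H0cls f = H0cls g.
Proof. by move=> fg; apply/qpi_eq/asboolP. Qed.

Lemma H0repr_cls x y (f : Z0 x y) :
  exists h, dgdeg (-1) h /\ dgd h = val (H0repr (H0cls f)) - val f.
Proof. exact/asboolP/(qrepr_sub (@dgexact x y) f). Qed.

Lemma H0comp_cls x y z (g : Z0 y z) (f : Z0 x y) :
  H0comp (H0cls g) (H0cls f) = H0cls (Z0comp g f).
Proof.
have [hg [hg1 dhg]] := H0repr_cls g; have [hf [hf1 dhf]] := H0repr_cls f.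
have [g0 dg] := Z0P g; have [f0 df] := Z0P (H0repr (H0cls f)).
apply: H0cls_eq.
exists (1 *: (hg \dco val (H0repr (H0cls f))) + val g \dco hf); split.
  apply: dgdeg_lin; first exact: (dgcomp_deg hg1 f0).
  exact: (dgcomp_deg g0 hf1).
rewrite dgd_lin (dgLeibniz _ hg1) (dgLeibniz _ g0) dg df dhg dhf /=.
rewrite dgcomp0m dgcompm0 scaler0 addr0 add0r expr0z !scale1r.
by rewrite dgcompBl dgcompBr addrA subrK.
Qed.

Definition H0 : lcat k.
Proof.
apply: (@LCat k A H0hom (fun x => H0cls (Z0id x)) H0comp).
- move=> x y z t h g f; rewrite -(H0reprK h) -(H0reprK g) -(H0reprK f).
  by rewrite !H0comp_cls; congr H0cls; apply: val_inj; rewrite /= dgcompA.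
- move=> x y f; rewrite -(H0reprK f) H0comp_cls; congr H0cls.
  by apply: val_inj; rewrite /= dgcomp1m.
- move=> x y f; rewrite -(H0reprK f) H0comp_cls; congr H0cls.
  by apply: val_inj; rewrite /= dgcompm1.
- move=> x y z f a g g'; rewrite -(H0reprK f) -(H0reprK g) -(H0reprK g').
  rewrite -H0cls_lin !H0comp_cls -H0cls_lin; congr H0cls.
  by apply: val_inj; rewrite /= dgcomp_linl.
- move=> x y z g a f f'; rewrite -(H0reprK f) -(H0reprK g) -(H0reprK f').
  rewrite -H0cls_lin !H0comp_cls -H0cls_lin; congr H0cls.
  by apply: val_inj; rewrite /= dgcomp_linr.
Defined.

(* y is x[1]: s is the closed degree -1 isomorphism underlying the identity. *)
Record is_dgshift x y (s : dghom x y) (r : dghom y x) : Prop := IsDGShift {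
  dgshift_deg : dgdeg (-1) s;
  dgshift_deg' : dgdeg 1 r;
  dgshift_d : dgd s = 0;
  dgshift_d' : dgd r = 0;
  dgshiftK : r \dco s = dgid x;
  dgshiftK' : s \dco r = dgid y }.

(* c is x[1] (+) y as a graded object, with i, q the inclusion of and projection
   to y, and j, p the (shifted) inclusion of and projection to x[1]; the
   differential is twisted by f. *)
Record is_dgcone x y c (f : dghom x y) (i : dghom y c) (q : dghom c y)
    (j : dghom x c) (p : dghom c x) : Prop := IsDGCone {
  dgcone_degi : dgdeg 0 i;
  dgcone_degq : dgdeg 0 q;
  dgcone_degj : dgdeg (-1) j;
  dgcone_degp : dgdeg 1 p;
  dgcone_qi : q \dco i = dgid y;
  dgcone_pj : p \dco j = dgid x;
  dgcone_pi : p \dco i = 0;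
  dgcone_qj : q \dco j = 0;
  dgcone_id : i \dco q + j \dco p = dgid c;
  dgcone_di : dgd i = 0;
  dgcone_dp : dgd p = 0;
  dgcone_dj : dgd j = i \dco f;
  dgcone_dq : dgd q = - (f \dco p) }.

End HomotopyCategory.

Record pretriangulated_dg (k : fieldType) := PretriangulatedDG {
  pdg :> dgcat k;
  pdg_sh : pdg -> pdg;
  pdg_s : forall x, dghom x (pdg_sh x);
  pdg_r : forall x, dghom (pdg_sh x) x;
  pdg_shP : forall x, is_dgshift (pdg_s x) (pdg_r x);
  pdg_desusp : forall y : pdg,
    exists (x : pdg) (s : dghom x y) (r : dghom y x), is_dgshift s r;
  pdg_cone : forall (x y : pdg) (f : dghom x y), dgdeg 0 f -> dgd f = 0 ->
    exists (c : pdg) i q j p, is_dgcone (c := c) f i q j p }.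

Section HomotopyTriangles.
Variables (k : fieldType) (A : pretriangulated_dg k).

Lemma Z0sh_proof (x y : A) (f : Z0 x y) :
  dgdeg 0 (pdg_s y \dco val f \dco pdg_r x) /\
  dgd (pdg_s y \dco val f \dco pdg_r x) = 0.
Proof.
have [f0 df] := Z0P f; have sP := pdg_shP y; have rP := pdg_shP x.
have sf : dgdeg (-1) (pdg_s y \dco val f).
  exact: (dgcomp_deg (dgshift_deg sP) f0).
split; first exact: (dgcomp_deg sf (dgshift_deg' rP)).
rewrite (dgLeibniz _ sf) (dgshift_d' rP) dgcompm0 scaler0 addr0.
rewrite (dgLeibniz _ (dgshift_deg sP)) (dgshift_d sP) df.
by rewrite dgcomp0m dgcompm0 scaler0 addr0 dgcomp0m.
Qed.

Definition Z0sh (x y : A) (f : Z0 x y) : Z0 (pdg_sh x) (pdg_sh y) :=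
  mkZ0 (proj1 (Z0sh_proof f)) (proj2 (Z0sh_proof f)).

Definition H0sh (x y : A) (f : H0hom x y) : H0hom (pdg_sh x) (pdg_sh y) :=
  H0cls (Z0sh (H0repr f)).

Lemma H0sh_cls (x y : A) (f : Z0 x y) : H0sh (H0cls f) = H0cls (Z0sh f).
Proof.
have [h [h1 dh]] := H0repr_cls f.
have sP := pdg_shP y; have rP := pdg_shP x.
apply: H0cls_eq; exists (- 1 *: (pdg_s y \dco h \dco pdg_r x) + 0).
have sh : dgdeg (-1 - 1) (pdg_s y \dco h) by exact: (dgcomp_deg (dgshift_deg sP) h1).
split.
  apply: dgdeg_lin; last exact: dgdeg0.
  exact: (dgcomp_deg sh (dgshift_deg' rP)).
rewrite dgd_lin dgd0 addr0 (dgLeibniz _ sh) (dgshift_d' rP) dgcompm0 scaler0 addr0.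
rewrite (dgLeibniz _ (dgshift_deg sP)) (dgshift_d sP) dgcomp0m add0r dh.
rewrite -[X in _ *: (X \dco _)]addr0 dgcomp_linl dgcomp0m addr0 scalerA.
rewrite (_ : -1 * (-1) ^ (-1) = 1) ?scale1r; last by rewrite exprN1 invrN1 mulrNN mul1r.
by rewrite dgcompBr dgcompBl.
Qed.

Definition H0susp : lfunctor (H0 A) (H0 A).
Proof.
apply: (@LFunctor k (H0 A) (H0 A) (@pdg_sh k A) H0sh).
- move=> x y a f g; rewrite -(H0reprK f) -(H0reprK g) -H0cls_lin !H0sh_cls.
  rewrite -H0cls_lin; congr H0cls; apply: val_inj.
  by rewrite /= dgcomp_linr dgcomp_linl.
- move=> x; rewrite /= H0sh_cls; congr H0cls; apply: val_inj.
  by rewrite /= dgcompm1 (dgshiftK' (pdg_shP x)).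
- move=> x y z g f; rewrite -(H0reprK f) -(H0reprK g) /= H0comp_cls !H0sh_cls.
  rewrite H0comp_cls; congr H0cls; apply: val_inj => /=.
  rewrite -!dgcompA; congr (_ \dco (_ \dco _)).
  by rewrite (dgcompA (pdg_r y)) (dgshiftK (pdg_shP y)) dgcomp1m.
Defined.

Definition H0dist (x y z : H0 A)
    (u : hom x y) (v : hom y z) (w : hom z (H0susp x)) : Prop :=
  exists (x' y' c : A) (f : Z0 x' y') i q j p (ci : Z0 y' c)
         (cw : Z0 c (pdg_sh x')),
    [/\ is_dgcone (val f) i q j p, val ci = i, val cw = pdg_s x' \dco p
      & triangle_iso (C := H0 A) (S := H0susp)
          u v w (H0cls f) (H0cls ci) (H0cls cw)].

Definition H0tri : tridata k := @TriData k (H0 A) H0susp H0dist.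

End HomotopyTriangles.

Definition algebraic (k : fieldType) (T : tridata k) : Prop :=
  exists (A : pretriangulated_dg k) (F : exact_functor (H0tri A) T),
    is_equivalence F.

Section Actions.
Variables (k : fieldType) (G : finGroupType) (T : tridata k).

(* The isomorphism F g x = F h x for g = h, used to compare F (g * (h * l))
   with F (g * h * l), whose indices are only provably equal. *)
Definition idx_cast (F : G -> exact_functor T T) (g h : G) (e : g = h) (x : T) :
  hom (F g x) (F h x) :=
  match e in _ = h return hom (F g x) (F h x) with erefl => idm (F g x) end.

(* The unit acts as the identity functor up to a coherent isomorphism of exact
   functors. *)
Record tri_action := TriAction {
  actF :> G -> exact_functor T T;
  actF_equiv : forall g, is_equivalence (actF g);
  actF_one : exact_iso (exact_id T) (actF 1%g);
  actF_mul : forall g h, exact_iso (exact_comp (actF g) (actF h)) (actF (g * h)%g);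
  actF_assoc : forall (g h l : G) (x : T),
    idx_cast actF (mulgA g h l) x
      \co (fwd (actF_mul g (h * l)%g x) \co fmap (actF g) (fwd (actF_mul h l x)))
    = fwd (actF_mul (g * h)%g l x) \co fwd (actF_mul g h (actF l x));
  actF_unitl : forall (g : G) (x : T),
    idx_cast actF (mul1g g) x \co (fwd (actF_mul 1%g g x) \co fwd (actF_one (actF g x)))
    = idm (actF g x);
  actF_unitr : forall (g : G) (x : T),
    idx_cast actF (mulg1 g) x
      \co (fwd (actF_mul g 1%g x) \co fmap (actF g) (fwd (actF_one x)))
    = idm (actF g x) }.

Definition image_subcat (a : tri_action) (g : G) (X : T -> Prop) (y : T) : Prop :=
  exists2 x, X x & isomorphic y (a g x).

Definition iso_closure (X : T -> Prop) (y : T) : Prop :=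
  exists2 x, X x & isomorphic y x.

(* Full subcategories need not be closed under isomorphism here, so gX = X is
   read as equality of isomorphism closures. *)
Definition invariant_subcat (a : tri_action) (X : T -> Prop) : Prop :=
  forall g y, image_subcat a g X y <-> iso_closure X y.

Definition invariant_pair (a : tri_action) (X Y : T -> Prop) : Prop :=
  invariant_subcat a X /\ invariant_subcat a Y.

End Actions.

Section Equivariant.
Variables (k : fieldType) (G : finGroupType) (T : tridata k) (a : tri_action G T).

Record eqobj := EqObj {
  eob :> T;
  elin : forall g, iso eob (a g eob);
  elinM : forall g h,
    fwd (elin (g * h)%g)
    = fwd (actF_mul a g h eob) \co fmap (a g) (fwd (elin h)) \co fwd (elin g) }.

Definition hom_act (s t : eqobj) (g : G) (f : hom (s : T) t) : hom (s : T) t :=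
  bwd (elin t g) \co fmap (a g) f \co fwd (elin s g).

Definition invariant_hom (s t : eqobj) : {pred hom (s : T) t} :=
  fun f => [forall g, hom_act g f == f].

Lemma hom_act_lin (s t : eqobj) g c (f f' : hom (s : T) t) :
  hom_act g (c *: f + f') = c *: hom_act g f + hom_act g f'.
Proof. by rewrite /hom_act fmap_lin comp_linr comp_linl. Qed.

Lemma invariant_homP (s t : eqobj) (f : hom (s : T) t) :
  reflect (forall g, fwd (elin t g) \co f = fmap (a g) f \co fwd (elin s g))
          (f \in @invariant_hom s t).
Proof.
apply: (iffP forallP) => fP g; last first.
  by rewrite /hom_act -compA -fP compA bwdK comp1m.
by have /eqP {1}<- := fP g; rewrite /hom_act !compA fwdK comp1m.
Qed.

Fact invariant_hom_submod (s t : eqobj) : submod_closed (@invariant_hom s t).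
Proof.
split.
  apply/forallP => g; have := hom_act_lin g (-1) (0 : hom (s : T) t) 0.
  by rewrite scaler0 addr0 scaleN1r addNr => ->.
move=> c f f' /forallP fP /forallP fP'; apply/forallP => g.
by rewrite hom_act_lin (eqP (fP g)) (eqP (fP' g)).
Qed.
HB.instance Definition _ (s t : eqobj) :=
  GRing.isSubmodClosed.Build k (hom (s : T) (t : T)) (@invariant_hom s t)
    (@invariant_hom_submod s t).

Definition ehom (s t : eqobj) : lmodType k := submodule (@invariant_hom s t).

Definition mkehom (s t : eqobj) (f : hom (s : T) t)
  (fP : f \in @invariant_hom s t) : ehom s t := exist _ f fP.

Fact eid_proof (s : eqobj) : idm (s : T) \in @invariant_hom s s.
Proof. by apply/invariant_homP => g; rewrite fmap1 comp1m compm1. Qed.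

Fact ecomp_proof (r s t : eqobj) (g : ehom s t) (f : ehom r s) :
  val g \co val f \in @invariant_hom r t.
Proof.
have /invariant_homP gP := valP g; have /invariant_homP fP := valP f.
by apply/invariant_homP => x; rewrite compA gP fmapM -!compA fP.
Qed.

Definition ecat : lcat k.
Proof.
apply: (@LCat k eqobj ehom (fun s => mkehom (eid_proof s))
          (fun r s t g f => mkehom (ecomp_proof g f))).
- by move=> *; apply: val_inj; rewrite /= compA.
- by move=> *; apply: val_inj; rewrite /= comp1m.
- by move=> *; apply: val_inj; rewrite /= compm1.
- by move=> *; apply: val_inj; rewrite /= comp_linl.
- by move=> *; apply: val_inj; rewrite /= comp_linr.
Defined.

Definition esusp_lin (t : eqobj) (g : G) : iso (susp t : T) (a g (susp t)) :=
  iso_comp (iso_inv (efun_susp (a g) t)) (iso_map susp (elin t g)).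

Lemma bwd_susp_nat (g : G) (x y : T) (f : hom x y) :
  bwd (efun_susp (a g) y) \co fmap susp (fmap (a g) f)
  = fmap (a g) (fmap susp f) \co bwd (efun_susp (a g) x).
Proof.
have /= N := nat_isoN (efun_susp (a g)) f.
rewrite -[LHS]compm1 -(fwdK (efun_susp (a g) x)) /= compA -(compA (bwd _)) -N.
by rewrite !compA bwdK comp1m.
Qed.

Fact esusp_linM (t : eqobj) g h :
  fwd (esusp_lin t (g * h)%g)
  = fwd (actF_mul a g h (susp t)) \co fmap (a g) (fwd (esusp_lin t h))
      \co fwd (esusp_lin t g).
Proof.
rewrite /= elinM !fmapM.
have /= E := eiso_susp (actF_mul a g h) t.
have {}E : bwd (efun_susp (a (g * h)%g) t) \co fmap susp (fwd (actF_mul a g h t))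
  = fwd (actF_mul a g h (susp t)) \co fmap (a g) (bwd (efun_susp (a h) t))
      \co bwd (efun_susp (a g) (a h t)).
  set r := (RHS).
  rewrite -[r]comp1m -(bwdK (efun_susp (a (g * h)%g) t)) /= -compA; congr (_ \co _).
  rewrite /r !compA E -!compA (compA (fmap (a g) _)) -fmapM.
  by rewrite (fwdK (efun_susp (a h) t)) fmap1 comp1m
             (fwdK (efun_susp (a g) (a h t))) compm1.
rewrite !compA E -!compA; congr (_ \co (_ \co _)); rewrite !compA.
by rewrite bwd_susp_nat.
Qed.

Definition esusp_obj (t : eqobj) : eqobj := EqObj (esusp_linM t).

Fact esusp_proof (s t : eqobj) (f : ehom s t) :
  fmap susp (val f) \in @invariant_hom (esusp_obj s) (esusp_obj t).
Proof.
have /invariant_homP fP := valP f.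
apply/invariant_homP => g /=.
by rewrite -compA -fmapM fP fmapM compA bwd_susp_nat -compA.
Qed.

Definition esusp : lfunctor ecat ecat.
Proof.
apply: (@LFunctor k ecat ecat esusp_obj
          (fun s t f => mkehom (esusp_proof f))).
- by move=> *; apply: val_inj; rewrite /= fmap_lin.
- by move=> *; apply: val_inj; rewrite /= fmap1.
- by move=> *; apply: val_inj; rewrite /= fmapM.
Defined.

Definition edist (x y z : ecat)
    (u : hom x y) (v : hom y z) (w : hom z (esusp x)) : Prop :=
  dist (val u) (val v) (val w : hom (eob z) (susp (eob x))).

Definition equivariant : tridata k := @TriData k ecat esusp edist.

Definition equivariant_subcat (X : T -> Prop) : equivariant -> Prop :=
  fun t => X (eob t).

End Equivariant.

(* Main.v *)
Require Import Defs.
From mathcomp Require Import all_boot all_order all_algebra all_fingroup.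
From mathcomp Require boolp.

(** A linearisation of [t] lifts along its truncation triangle [x -> t -> y]:
    since there are no nonzero maps from [x] or [Sigma x] to [g y], a morphism
    [t -> g t] extends uniquely to a morphism of triangles.  Existence gives
    isomorphisms [x -> g x] and [y -> g y] for which all three maps of the
    triangle are equivariant; uniqueness gives the cocycle conditions. *)

Set Implicit Arguments.
Unset Strict Implicit.
Unset Printing Implicit Defensive.
Import GRing.Theory.
Import Defs.
Local Open Scope ring_scope.
Local Notation "g \co f" := (comp g f).

(** * Composition, functors and equivalences of linear categories *)

Section LinearCategory.
Variables (k : fieldType) (C : lcat k).
Implicit Types x y z : C.

Lemma comp0m x y z (f : hom x y) : (0 : hom y z) \co f = 0.
Proof.
by have := comp_linl f (-1) (0 : hom y z) 0; rewrite scaler0 addr0 scaleN1r addNr.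
Qed.

Lemma compm0 x y z (g : hom y z) : g \co (0 : hom x y) = 0.
Proof.
by have := comp_linr g (-1) (0 : hom x y) 0; rewrite scaler0 addr0 scaleN1r addNr.
Qed.

Lemma compNm x y z (g : hom y z) (f : hom x y) : (- g) \co f = - (g \co f).
Proof. by have := comp_linl f (-1) g 0; rewrite comp0m !addr0 !scaleN1r. Qed.

Lemma compmN x y z (g : hom y z) (f : hom x y) : g \co (- f) = - (g \co f).
Proof. by have := comp_linr g (-1) f 0; rewrite compm0 !addr0 !scaleN1r. Qed.

Lemma compBm x y z (g g' : hom y z) (f : hom x y) :
  (g - g') \co f = g \co f - g' \co f.
Proof. by have := comp_linl f 1 g (- g'); rewrite !scale1r compNm. Qed.

Lemma compmB x y z (g : hom y z) (f f' : hom x y) :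
  g \co (f - f') = g \co f - g \co f'.
Proof. by have := comp_linr g 1 f (- f'); rewrite !scale1r compmN. Qed.

End LinearCategory.

Section LinearFunctor.
Variables (k : fieldType) (C D : lcat k) (F : lfunctor C D).

Lemma fmap0 (x y : C) : fmap F (0 : hom x y) = 0.
Proof.
by have := fmap_lin F (-1) (0 : hom x y) 0; rewrite scaler0 addr0 scaleN1r addNr.
Qed.

Lemma fmapB (x y : C) (f g : hom x y) : fmap F (f - g) = fmap F f - fmap F g.
Proof.
by have := fmap_lin F (-1) g f; rewrite !scaleN1r ![- _ + _]addrC.
Qed.

Lemma fmap_is_zero (x : C) : is_zero x -> is_zero (F x).
Proof. by rewrite /is_zero -fmap1 => ->; rewrite fmap0. Qed.

End LinearFunctor.

(** Conjugation by [e] recovers [f] from its image under [L] and [F]. A one-sided inverse suffices,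
    so the lemma also applies to the quasi-inverse of an equivalence. *)
Lemma left_inverse_faithful (k : fieldType) (C D : lcat k) (F : lfunctor C D)
    (L : lfunctor D C) (e : nat_iso (lfunctor_comp L F) (lfunctor_id C))
    (x y : C) (f g : hom x y) :
  fmap F f = fmap F g -> f = g.
Proof.
move=> E; have /= Nf := nat_isoN e f; have /= Ng := nat_isoN e g.
rewrite -[f]compm1 -[g]compm1 -(fwdK (e x)) /= !compA.
by rewrite -Nf -Ng E.
Qed.

Section Equivalence.
Variables (k : fieldType) (C D : lcat k) (F : lfunctor C D).
Hypothesis F_equiv : is_equivalence F.

Lemma equivalence_faithful (x y : C) (f g : hom x y) :
  fmap F f = fmap F g -> f = g.
Proof. by have [L [[e] _]] := F_equiv; apply: (left_inverse_faithful e). Qed.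

Lemma equivalence_full (x y : C) (h : hom (F x) (F y)) :
  exists f : hom x y, fmap F f = h.
Proof.
have [L [[e] [e']]] := F_equiv.
exists (fwd (e y) \co fmap L h \co bwd (e x)).
(* The quasi-inverse [L] is faithful, so the equation is checked after applying [L]. *)
apply: (left_inverse_faithful e').
set f := (fwd _ \co _ \co _); have /= N := nat_isoN e f.
rewrite -[LHS]comp1m -(bwdK (e y)) /= -compA N /f -!compA bwdK /= compm1.
by rewrite compA bwdK comp1m.
Qed.

End Equivalence.

(** * Factorisation and cancellation in distinguished triangles *)

Section Triangles.
Variables (k : fieldType) (T : tridata k).
Hypothesis T_tr : triangulated T.
Implicit Types x y z s : T.

(** The factorisation is the third component of a morphism to the triangle on [0 -> s -> s], whose
    rotation is an identity triangle. *)
Lemma tri_cofactor x y z s (u : hom x y) (v : hom y z) (w : hom z (susp x))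
    (h : hom y s) :
  dist u v w -> h \co u = 0 -> exists c : hom z s, c \co v = h.
Proof.
move=> D hu; have [[o o0] _] := tr_additive T_tr.
have Ds : dist (0 : hom o s) (idm s) (0 : hom s (susp o)).
  apply/(tr_rot T_tr); rewrite fmap0 oppr0.
  by apply: (tr_id T_tr); apply: fmap_is_zero.
have [|c [E _]] := tr_mor T_tr (a := 0) (b := h) D Ds; first by rewrite hu comp0m.
by exists c; rewrite E comp1m.
Qed.

(** The suspension of [f - g] factors, up to sign, through [w] by a map from [susp s] to [z], hence
    vanishes; suspension is faithful. *)
Lemma tri_mono x y z s (u : hom x y) (v : hom y z) (w : hom z (susp x)) :
  dist u v w -> (forall c : hom (susp s) z, c = 0) ->
  forall f g : hom s x, u \co f = u \co g -> f = g.
Proof.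
move=> D H0 f g E; have [[o o0] _] := tr_additive T_tr.
have Ds := proj1 (tr_rot T_tr _ _ _) (tr_id T_tr s o0).
rewrite fmap1 in Ds.
have [|c [_]] := tr_mor T_tr (a := f - g) (b := 0) Ds D.
  by rewrite comp0m compmB E subrr.
rewrite (H0 c) compm0 compmN compm1 fmapB => /eqP.
rewrite oppr_eq0 subr_eq0 => /eqP.
exact: (equivalence_faithful (tr_susp T_tr)).
Qed.

(** Since [f - g] kills [v], it factors through [w] by a map from [susp x] to [s]. *)
Lemma tri_epi x y z s (u : hom x y) (v : hom y z) (w : hom z (susp x)) :
  dist u v w -> (forall c : hom (susp x) s, c = 0) ->
  forall f g : hom z s, f \co v = g \co v -> f = g.
Proof.
move=> D H0 f g E.
have Dr := proj1 (tr_rot T_tr _ _ _) D.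
have [|c] := tri_cofactor (h := f - g) Dr.
  by rewrite compBm E subrr.
by rewrite (H0 c) comp0m => /esym/eqP; rewrite subr_eq0 => /eqP.
Qed.

(** The composite of [u], [b] and [v'] is a map from [x] to [z'], hence zero, which yields [c]; the
    rotated triangles then yield [a] up to suspension. *)
Lemma tri_extend x y z x' y' z'
    (u : hom x y) (v : hom y z) (w : hom z (susp x))
    (u' : hom x' y') (v' : hom y' z') (w' : hom z' (susp x')) (b : hom y y') :
  dist u v w -> dist u' v' w' -> (forall f : hom x z', f = 0) ->
  exists (a : hom x x') (c : hom z z'),
    [/\ u' \co a = b \co u, c \co v = v' \co b & fmap susp a \co w = w' \co c].
Proof.
move=> D D' H0.
have [c cv] := tri_cofactor (h := v' \co b) D (H0 _).
have [d [dw E]] :=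
  tr_mor T_tr (proj1 (tr_rot T_tr _ _ _) D) (proj1 (tr_rot T_tr _ _ _) D') cv.
(* Fullness of suspension turns [d], a map from [susp x] to [susp x'], into [a]. *)
have [a ad] := equivalence_full (tr_susp T_tr) d; exists a, c; split=> //.
  apply: (equivalence_faithful (tr_susp T_tr)); apply: oppr_inj.
  by rewrite !fmapM ad -compNm -E compmN.
by rewrite ad.
Qed.

Section Truncation.
Variables X Y : T -> Prop.
Hypothesis X_susp : forall x, X x -> X (susp x).
Hypothesis XY_hom : forall x y, X x -> Y y -> forall f : hom x y, f = 0.

(** Both [b] and its inverse extend; by [tri_mono] and [tri_epi] the extensions are mutually
    inverse. The two isomorphisms form one pair so that a single choice extracts both. *)
Lemma truncation_iso x y z x' y' z'
    (u : hom x y) (v : hom y z) (w : hom z (susp x))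
    (u' : hom x' y') (v' : hom y' z') (w' : hom z' (susp x')) (b : iso y y') :
  X x -> X x' -> Y z -> Y z' -> dist u v w -> dist u' v' w' ->
  exists ac : iso x x' * iso z z',
    [/\ u' \co fwd ac.1 = fwd b \co u, fwd ac.2 \co v = v' \co fwd b
      & fmap susp (fwd ac.1) \co w = w' \co fwd ac.2].
Proof.
move=> Xx Xx' Yz Yz' D D'.
have [a [c [ua cv ac]]] := tri_extend (fwd b) D D' (XY_hom Xx Yz').
have [a' [c' [ua' cv' _]]] := tri_extend (bwd b) D' D (XY_hom Xx' Yz).
have mono := fun s Xs => tri_mono (s := s) D (XY_hom (X_susp Xs) Yz).
have mono' := fun s Xs => tri_mono (s := s) D' (XY_hom (X_susp Xs) Yz').
have epi := fun s Ys => tri_epi (s := s) D (XY_hom (X_susp Xx) Ys).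
have epi' := fun s Ys => tri_epi (s := s) D' (XY_hom (X_susp Xx') Ys).
have a'a : a' \co a = idm x.
  by apply: mono => //; rewrite compA ua' -compA ua compA bwdK comp1m compm1.
have aa' : a \co a' = idm x'.
  by apply: mono' => //; rewrite compA ua -compA ua' compA fwdK comp1m compm1.
have c'c : c' \co c = idm z.
  by apply: epi => //; rewrite -compA cv compA cv' -compA bwdK comp1m compm1.
have cc' : c \co c' = idm z'.
  by apply: epi' => //; rewrite -compA cv' compA cv -compA fwdK comp1m compm1.
by exists (Iso a'a aa', Iso c'c cc').
Qed.

End Truncation.
End Triangles.

(** * Isomorphism closures of the two subcategories *)

Section IsoClosure.
Variables (k : fieldType) (T : tridata k) (X Y : T -> Prop).

(** Invariance places [a g x] only in the isomorphism closure of [X], so the t-structure axioms used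
    for truncation are transferred to closures. *)
Lemma iso_closure_susp :
  (forall x, X x -> X (susp x)) ->
  forall x, iso_closure X x -> iso_closure X (susp x).
Proof.
move=> X_susp x [x' Xx' [i]]; exists (susp x'); first exact: X_susp.
by split; exact: (iso_map susp i).
Qed.

Lemma iso_closure_hom :
  (forall x y, X x -> Y y -> forall f : hom x y, f = 0) ->
  forall x y, iso_closure X x -> iso_closure Y y -> forall f : hom x y, f = 0.
Proof.
move=> XY0 x y [x' Xx' [i]] [y' Yy' [j]] f.
have E : fwd j \co f \co bwd i = 0 by exact: XY0.
rewrite -[f]comp1m -(bwdK j) -[LHS]compm1 -(bwdK i).
by rewrite -!compA (compA f) (compA (fwd j)) (compA (fwd j)) E comp0m compm0.
Qed.

Lemma sub_iso_closure x : X x -> iso_closure X x.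
Proof. by exists x => //; split; exact: iso_id. Qed.

Lemma iso_closure_act (G : finGroupType) (a : tri_action G T) g x :
  invariant_subcat a X -> X x -> iso_closure X (a g x).
Proof. by move=> inv Xx; apply/(inv g); exists x => //; split; exact: iso_id. Qed.

End IsoClosure.

(** * Lifting linearisations to truncation triangles *)

Section EquivariantTruncation.
Variables (k : fieldType) (G : finGroupType) (T : tridata k).
Variables (a : tri_action G T) (X Y : T -> Prop).
Hypothesis T_tr : triangulated T.
Hypothesis XY_t : t_structure X Y.
Hypothesis XY_inv : invariant_pair a X Y.

Lemma equivariant_truncation (t : equivariant a) :
  exists (x y : equivariant a) (u : hom x t) (v : hom t y) (w : hom y (susp x)),
    [/\ equivariant_subcat X x, equivariant_subcat Y y & dist u v w].
Proof.
have [x [y [u [v [w [Xx Yy D]]]]]] := ts_tri XY_t (eob t).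
have Xs := iso_closure_susp (ts_susp XY_t).
have XY0 := iso_closure_hom (ts_hom XY_t).
have [Xi Yi] := XY_inv.
have Dg g := efun_dist (a g) D.
have Xx' := sub_iso_closure Xx; have Yy' := sub_iso_closure Yy.
have Xg g := iso_closure_act g Xi Xx; have Yg g := iso_closure_act g Yi Yy.
(* One extension is chosen independently for each [g]; uniqueness later forces the choices to be
   compatible. *)
have L g := boolp.cid (truncation_iso T_tr Xs XY0 (elin t g)
  Xx' (Xg g) Yy' (Yg g) D (Dg g)).
pose sx g := (projT1 (L g)).1; pose sy g := (projT1 (L g)).2.
have ux g : fmap (a g) u \co fwd (sx g) = fwd (elin t g) \co u.
  by case: (projT2 (L g)).
have vy g : fwd (sy g) \co v = fmap (a g) v \co fwd (elin t g).
  by case: (projT2 (L g)).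
have wxy g : fmap susp (fwd (sx g)) \co w
    = fwd (efun_susp (a g) x) \co fmap (a g) w \co fwd (sy g).
  by case: (projT2 (L g)).
have sxM g h : fwd (sx (g * h)%g)
    = fwd (actF_mul a g h x) \co fmap (a g) (fwd (sx h)) \co fwd (sx g).
  (* Both sides agree after composition with the image of [u] under [g * h], by the cocycle
     condition for [t] and naturality of [actF_mul]. *)
  apply: (tri_mono T_tr (Dg (g * h)%g) (XY0 _ _ (Xs _ Xx') (Yg _))).
  have /= N := nat_isoN (actF_mul a g h) u.
  rewrite ux elinM !compA -N -!compA -ux !(compA (fmap _ _) (fmap _ _)).
  by rewrite -!fmapM ux.
have syM g h : fwd (sy (g * h)%g)
    = fwd (actF_mul a g h y) \co fmap (a g) (fwd (sy h)) \co fwd (sy g).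
  (* Dually, both sides agree after precomposition with [v]. *)
  apply: (tri_epi T_tr D (XY0 _ _ (Xs _ Xx') (Yg _))).
  have /= N := nat_isoN (actF_mul a g h) v.
  rewrite vy elinM -!compA vy !compA -N -(compA _ _ (fmap _ v)) -fmapM vy.
  by rewrite fmapM !compA.
pose ex : equivariant a := EqObj sxM; pose ey : equivariant a := EqObj syM.
have uP : (u : hom (eob ex) (eob t)) \in invariant_hom (s := ex) (t := t).
  by apply/invariant_homP => g; rewrite /= ux.
have vP : (v : hom (eob t) (eob ey)) \in invariant_hom (s := t) (t := ey).
  by apply/invariant_homP => g; rewrite /= vy.
have wP : (w : hom (eob ey) (eob (esusp_obj ex)))
    \in invariant_hom (s := ey) (t := esusp_obj ex).
  (* The linearisation of [susp x] contains the inverse of [efun_susp], which cancels the factor in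
     [wxy]. *)
  by apply/invariant_homP => g /=; rewrite -compA wxy !compA bwdK comp1m.
by exists ex, ey, (mkehom uP), (mkehom vP), (mkehom wP).
Qed.

End EquivariantTruncation.

Theorem proposition7p3 (k : closedFieldType) (char0 : [pchar k]%R =i pred0)
    (G : finGroupType) (T : tridata k)
    (T_triangulated : triangulated T) (T_algebraic : algebraic T)
    (a : tri_action G T) (X Y : T -> Prop)
    (XY_tstruct : t_structure X Y) (XY_inv : invariant_pair a X Y) :
  t_structure (T := equivariant a)
    (equivariant_subcat (a := a) X) (equivariant_subcat (a := a) Y).
Proof.
split.
- by move=> x; apply: (ts_susp XY_tstruct).
- by move=> x y Xx Yy f; apply: val_inj; exact: (ts_hom XY_tstruct Xx Yy).
- exact: (equivariant_truncation T_triangulated XY_tstruct XY_inv).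
Qed.
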